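(* A set $\mathcal A\subseteq\mathbb N$ is provably decidable in $\mathbf{BA}$ if and only if $\mathcal A$ is finite or co-finite (i.e. $\mathbb N\setminus\mathcal A$ is finite).
   Context: Basic Arithmetic $\mathbf{BA}$ (Ruitenburg) is the following theory of sequents $A\Rightarrow B$ in the language $\{0,S,+,\cdot\}$, where formulas are built from atomic formulas ($s=t$, $\top$, $\bot$) by $\land,\lor,\exists x$ and the former $\forall\mathbf x(A\to B)$ ($\mathbf x$ a finite, possibly empty, sequence of variables; empty gives $A\to B$). Logical part (Basic Predicate Calculus): axioms $A\Rightarrow A$; $A\Rightarrow\top$; $\bot\Rightarrow A$; $A\land(B\lor C)\Rightarrow(A\land B)\lor(A\land C)$; $A\land\exists xB\Rightarrow\exists x(A\land B)$ ($x$ not free in $A$); $\top\Rightarrow x=x$; $x=y\land A\Rightarrow A[x/y]$ ($A$ atomic); $\forall\mathbf x(A\to B)\land\forall\mathbf x(B\to C)\Rightarrow\forall\mathbf x(A\to C)$; $\forall\mathbf x(A\to B)\land\forall\mathbf x(A\to C)\Rightarrow\forall\mathbf x(A\to B\land C)$; $\forall\mathbf x(B\to A)\land\forall\mathbf x(C\to A)\Rightarrow\forall\mathbf x(B\lor C\to A)$; $\forall\mathbf x(A\to B)\Rightarrow\forall\mathbf x(A[\mathbf x/\mathbf t]\to B[\mathbf x/\mathbf t])$; $\forall\mathbf x(A\to B)\Rightarrow\forall\mathbf y(A\to B)$ (no variable of $\mathbf y$ free on the left); $\forall\mathbf yx(B\to A)\Rightarrow\forall\mathbf y(\exists xB\to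 A)$ ($x$ not free in $A$); rules: transitivity; $A\Rightarrow B\land C$ iff $A\Rightarrow B$ and $A\Rightarrow C$; $B\lor C\Rightarrow A$ iff $B\Rightarrow A$ and $C\Rightarrow A$; term substitution; $\exists xB\Rightarrow A$ iff $B\Rightarrow A$ ($x$ not free in $A$); from $A\land B\Rightarrow C$ infer $A\Rightarrow\forall\mathbf x(B\to C)$ (no variable of $\mathbf x$ free in $A$). Arithmetic part: $Sx=0\Rightarrow\bot$; $Sx=Sy\Rightarrow x=y$; $x+0=x$; $x+Sy=S(x+y)$; $x\cdot0=0$; $x\cdot Sy=x\cdot y+x$; induction axiom schema $\forall\mathbf yx(A\to A[x/Sx])\Rightarrow\forall\mathbf yx(A[x/0]\to A)$; induction rule: from $A\Rightarrow A[x/Sx]$ infer $A[x/0]\Rightarrow A$. Here $s<t$ abbreviates $\exists x(s+Sx=t)$. $\Delta_0$ formulas: smallest class containing atomic formulas, closed under $\land,\lor,\to$ and bounded quantifiers $\exists x(x<s\land A)$, $\forall x(x<s\to A)$; $\Sigma_1$: $\exists\mathbf xA$ with $A\in\Delta_0$. A function $f:\mathbb N^n\to\mathbb N$ is provably recursive in $\mathbf{BA}$ if there is a $\Sigma_1$ formula $A(\mathbf x,y)$ with $\mathbb N\models A(\mathbf a,b)\iff f(\mathbf a)=b$ for all $\mathbf a,b$, such that $\mathbf{BA}\vdash\top\Rightarrow\exists yA(\mathbf x,y)$ and $\mathbf{BA}\vdash A(\mathbf x,u)\land A(\mathbf x,v)\Rightarrow u=v$. A set $\mathcal A\subseteq\mathbb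 N$ is provably decidable in $\mathbf{BA}$ if its characteristic function $\chi_{\mathcal A}$ is provably recursive in $\mathbf{BA}$. *)

(* Defs.v *)
From mathcomp Require Import all_boot.
From mathcomp Require Import boolp classical_sets cardinality.

Set Implicit Arguments.
Unset Strict Implicit.
Unset Printing Implicit Defensive.

Inductive term : Type :=
| Var of nat
| Zero
| Succ of term
| Add of term & term
| Mul of term & term.

(* [All xs A B] is the former "forall xs (A -> B)". *)
Inductive form : Type :=
| Eq of term & term
| Top
| Bot
| And of form & form
| Or of form & form
| Ex of nat & form
| All of seq nat & form & form.

Definition Imp (A B : form) : form := All [::] A B.

Definition atomic (A : form) : bool :=
  match A with Eq _ _ | Top | Bot => true | _ => false end.

Fixpoint tvars (t : term) : seq nat :=
  match t with
  | Var x => [:: x]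
  | Zero => [::]
  | Succ t => tvars t
  | Add s t | Mul s t => tvars s ++ tvars t
  end.

Fixpoint fv (A : form) : seq nat :=
  match A with
  | Eq s t => tvars s ++ tvars t
  | Top | Bot => [::]
  | And A B | Or A B => fv A ++ fv B
  | Ex x A => [seq z <- fv A | z != x]
  | All xs A B => [seq z <- fv A ++ fv B | z \notin xs]
  end.

Fixpoint tsubst (s : nat -> term) (t : term) : term :=
  match t with
  | Var x => s x
  | Zero => Zero
  | Succ t => Succ (tsubst s t)
  | Add t u => Add (tsubst s t) (tsubst s u)
  | Mul t u => Mul (tsubst s t) (tsubst s u)
  end.

Definition mask_sub (xs : seq nat) (s : nat -> term) : nat -> term :=
  fun z => if z \in xs then Var z else s z.

(* Simultaneous replacement of the free occurrences of variables; bound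
   variables are not renamed, so it is only meaningful under [free_for]. *)
Fixpoint subst (s : nat -> term) (A : form) : form :=
  match A with
  | Eq t u => Eq (tsubst s t) (tsubst s u)
  | Top => Top
  | Bot => Bot
  | And A B => And (subst s A) (subst s B)
  | Or A B => Or (subst s A) (subst s B)
  | Ex x A => Ex x (subst (mask_sub [:: x] s) A)
  | All xs A B =>
      All xs (subst (mask_sub xs s) A) (subst (mask_sub xs s) B)
  end.

(* No variable of the substituted terms is captured by a quantifier of [A]. *)
Fixpoint free_for (s : nat -> term) (A : form) : bool :=
  match A with
  | Eq _ _ | Top | Bot => true
  | And A B | Or A B => free_for s A && free_for s B
  | Ex x B =>
      all (fun z => x \notin tvars (s z)) (fv A)
      && free_for (mask_sub [:: x] s) B
  | All xs B C =>
      all (fun z => ~~ has (mem xs) (tvars (s z))) (fv A)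
      && (free_for (mask_sub xs s) B && free_for (mask_sub xs s) C)
  end.

(* The substitution [xs/ts]; used with [size ts = size xs]. *)
Definition subs (xs : seq nat) (ts : seq term) : nat -> term :=
  fun z => nth (Var z) ts (index z xs).

Definition sub1 (x : nat) (t : term) : nat -> term := subs [:: x] [:: t].

(* [BA A B] means that the sequent A => B is derivable.  The substitutions
   [x/0] and [x/Sx] and those into atomic formulas cannot capture variables,
   so they need no side condition. *)
Inductive BA : form -> form -> Prop :=
| BA_id A : BA A A
| BA_top A : BA A Top
| BA_bot A : BA Bot A
| BA_distr A B C : BA (And A (Or B C)) (Or (And A B) (And A C))
| BA_distr_ex x A B :
    x \notin fv A -> BA (And A (Ex x B)) (Ex x (And A B))
| BA_eq_refl x : BA Top (Eq (Var x) (Var x))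
| BA_eq_subst x y A :
    atomic A -> BA (And (Eq (Var x) (Var y)) A) (subst (sub1 x (Var y)) A)
| BA_all_trans xs A B C :
    BA (And (All xs A B) (All xs B C)) (All xs A C)
| BA_all_and xs A B C :
    BA (And (All xs A B) (All xs A C)) (All xs A (And B C))
| BA_all_or xs A B C :
    BA (And (All xs B A) (All xs C A)) (All xs (Or B C) A)
| BA_all_subst xs ts A B :
    uniq xs -> size ts = size xs ->
    free_for (subs xs ts) A -> free_for (subs xs ts) B ->
    BA (All xs A B) (All xs (subst (subs xs ts) A) (subst (subs xs ts) B))
| BA_all_vars xs ys A B :
    ~~ has (mem (fv (All xs A B))) ys -> BA (All xs A B) (All ys A B)
| BA_all_ex ys x A B :
    x \notin fv A -> BA (All (rcons ys x) B A) (All ys (Ex x B) A)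
| BA_trans A B C : BA A B -> BA B C -> BA A C
| BA_andI A B C : BA A B -> BA A C -> BA A (And B C)
| BA_andEl A B C : BA A (And B C) -> BA A B
| BA_andEr A B C : BA A (And B C) -> BA A C
| BA_orE A B C : BA B A -> BA C A -> BA (Or B C) A
| BA_orIl A B C : BA (Or B C) A -> BA B A
| BA_orIr A B C : BA (Or B C) A -> BA C A
| BA_subst x t A B :
    free_for (sub1 x t) A -> free_for (sub1 x t) B ->
    BA A B -> BA (subst (sub1 x t) A) (subst (sub1 x t) B)
| BA_exE x A B : x \notin fv A -> BA B A -> BA (Ex x B) A
| BA_exI x A B : x \notin fv A -> BA (Ex x B) A -> BA B A
| BA_allI xs A B C :
    ~~ has (mem (fv A)) xs -> BA (And A B) C -> BA A (All xs B C)
| BA_succ_neq0 x : BA (Eq (Succ (Var x)) Zero) Bot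
| BA_succ_inj x y :
    BA (Eq (Succ (Var x)) (Succ (Var y))) (Eq (Var x) (Var y))
| BA_add0 x : BA Top (Eq (Add (Var x) Zero) (Var x))
| BA_addS x y :
    BA Top (Eq (Add (Var x) (Succ (Var y))) (Succ (Add (Var x) (Var y))))
| BA_mul0 x : BA Top (Eq (Mul (Var x) Zero) Zero)
| BA_mulS x y :
    BA Top (Eq (Mul (Var x) (Succ (Var y))) (Add (Mul (Var x) (Var y)) (Var x)))
| BA_induction_ax ys x A :
    BA (All (rcons ys x) A (subst (sub1 x (Succ (Var x))) A))
       (All (rcons ys x) (subst (sub1 x Zero) A) A)
| BA_induction_rule x A :
    BA A (subst (sub1 x (Succ (Var x))) A) -> BA (subst (sub1 x Zero) A) A.

(* [Lt z s t] is "exists z (s + S z = t)", an instance of the abbreviation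
   s < t as soon as [z] occurs neither in [s] nor in [t]. *)
Definition Lt (z : nat) (s t : term) : form :=
  Ex z (Eq (Add s (Succ (Var z))) t).

Inductive Delta0 : form -> Prop :=
| Delta0_atomic A : atomic A -> Delta0 A
| Delta0_and A B : Delta0 A -> Delta0 B -> Delta0 (And A B)
| Delta0_or A B : Delta0 A -> Delta0 B -> Delta0 (Or A B)
| Delta0_imp A B : Delta0 A -> Delta0 B -> Delta0 (Imp A B)
| Delta0_ex x z s A :
    x \notin tvars s -> z \notin x :: tvars s -> Delta0 A ->
    Delta0 (Ex x (And (Lt z (Var x) s) A))
| Delta0_all x z s A :
    x \notin tvars s -> z \notin x :: tvars s -> Delta0 A ->
    Delta0 (All [:: x] (Lt z (Var x) s) A).

Definition Sigma1 (A : form) : Prop :=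
  exists (xs : seq nat) (B : form), Delta0 B /\ A = foldr Ex B xs.

Fixpoint teval (e : nat -> nat) (t : term) : nat :=
  match t with
  | Var x => e x
  | Zero => 0
  | Succ t => (teval e t).+1
  | Add s t => teval e s + teval e t
  | Mul s t => teval e s * teval e t
  end.

(* Satisfaction in the standard model; [e'] ranges over the assignments that
   agree with [e] outside the quantified variables. *)
Fixpoint sat (e : nat -> nat) (A : form) : Prop :=
  match A with
  | Eq s t => teval e s = teval e t
  | Top => True
  | Bot => False
  | And A B => sat e A /\ sat e B
  | Or A B => sat e A \/ sat e B
  | Ex x A =>
      exists e' : nat -> nat, (forall z, z != x -> e' z = e z) /\ sat e' A
  | All xs A B =>
      forall e' : nat -> nat, (forall z, z \notin xs -> e' z = e z) ->
        sat e' A -> sat e' B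
  end.

(* The tuple [xs] and the variable [y] are the displayed variables of A(xs, y),
   and A(xs, u) is A[y/u]; as [xs] and [y] are distinct, (map e xs, e y)
   ranges over all (a, b) when [e] ranges over all assignments. *)
Definition provably_recursive (n : nat) (f : n.-tuple nat -> nat) : Prop :=
  exists (A : form) (xs : n.-tuple nat) (y u v : nat),
    [/\ Sigma1 A, uniq [:: y, u, v & xs] & {subset fv A <= y :: xs}] /\
    (forall e : nat -> nat, sat e A <-> f (map_tuple e xs) = e y) /\
    BA Top (Ex y A) /\
    [/\ free_for (sub1 y (Var u)) A, free_for (sub1 y (Var v)) A
      & BA (And (subst (sub1 y (Var u)) A) (subst (sub1 y (Var v)) A))
           (Eq (Var u) (Var v))].

Definition char_fun (X : set nat) (n : nat) : nat := (n \in X : bool).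

Definition provably_decidable (X : set nat) : Prop :=
  provably_recursive (fun a : 1.-tuple nat => char_fun X (thead a)).

(* Main.v *)
Require Import Defs.
From mathcomp Require Import all_boot.
From mathcomp Require Import boolp classical_sets cardinality.
From mathcomp Require Import zify.

(** Read every formula in the one-point compactification of the natural numbers,
    with every [forall xs (A -> B)] declared true (a single irreflexive Kripke
    node).  The semiring operations are continuous there, so definable sets are
    closed, and this validates the induction rule; hence BA is sound for this
    reading.  Truth in the standard model implies truth in this one.  If the
    graph of the characteristic function contained infinitely many points (n, 0)
    and infinitely many points (n, 1), closedness would put both (oo, 0) and
    (oo, 1) in the graph, against provable functionality.  Conversely an
    eventually constant function is given by a finite table whose last row is
    [exists z, x = S^N z /\ y = b], and BA proves that it is total and
    functional. *)

Set Implicit Arguments.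
Unset Strict Implicit.
Unset Printing Implicit Defensive.

Local Open Scope classical_set_scope.

(** * Substitution and variable capture *)

Lemma subst_ex s x A : subst s (Ex x A) = Ex x (subst (mask_sub [:: x] s) A).
Proof. by []. Qed.

Lemma free_for_ex s x A : free_for s (Ex x A) =
  all (fun z => x \notin tvars (s z)) (fv (Ex x A))
  && free_for (mask_sub [:: x] s) A.
Proof. by []. Qed.

Lemma fv_ex x A : fv (Ex x A) = [seq z <- fv A | z != x].
Proof. by []. Qed.

Lemma sub1E x t z : sub1 x t z = if z == x then t else Var z.
Proof. by rewrite /sub1 /subs /= eq_sym; case: eqP. Qed.

Lemma mask_sub1E x s z : mask_sub [:: x] s z = if z == x then Var z else s z.
Proof. by rewrite /mask_sub inE. Qed.

(** Capture needs a bound variable inside the term put for another variable, and here the term put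
    for [z] contains at most [z]. This covers [[x/0]] and [[x/Sx]]. *)
Lemma free_for_own s A :
  (forall z, {subset tvars (s z) <= [:: z]}) -> free_for s A.
Proof.
have mask xs s' : (forall z, {subset tvars (s' z) <= [:: z]}) ->
    forall z, {subset tvars (mask_sub xs s' z) <= [:: z]}.
  by move=> h z; rewrite /mask_sub; case: ifP => _; [by move=> w|exact: h].
elim: A s => //= [A IA B IB|A IA B IB|x A IA|xs A IA B IB] s h.
- by rewrite IA ?IB.
- by rewrite IA ?IB.
- rewrite IA ?andbT; last exact: mask.
  apply/allP => z; rewrite mem_filter => /andP[zx _].
  by apply/negP => /h; rewrite inE eq_sym (negbTE zx).
- rewrite IA ?IB ?andbT; try exact: mask.
  apply/allP => z; rewrite mem_filter => /andP[zx _].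
  apply/hasPn => w /h; rewrite inE => /eqP ->; exact: zx.
Qed.

Lemma free_for_atomic s A : atomic A -> free_for s A.
Proof. by case: A. Qed.

(** * The compactified natural numbers *)

(* [None] is the point at infinity. *)
Definition cnat := option nat.

Definition cadd (a b : cnat) : cnat :=
  if a is Some m then if b is Some n then Some (m + n) else None else None.

(** Zero times infinity is zero: the limit of the products [0 * n], and the value that the axiom for
    [x * 0] requires. *)
Definition cmul (a b : cnat) : cnat :=
  match a, b with
  | Some 0, _ | _, Some 0 => Some 0
  | Some m, Some n => Some (m * n)
  | _, _ => None
  end.

(** Infinity shares its [trunc m] exactly with the numbers from [m] on, so [trunc m] describes the
    neighbourhoods of the compactification at scale [m]. *)
Definition trunc (m : nat) (a : cnat) : nat :=
  if a is Some n then minn n m else m.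

(** Uniform continuity: the arguments at scale [m] determine the value at scale [m]. The same holds
    for products and successors below. *)
Lemma trunc_add m a b : trunc m (cadd a b) = minn (trunc m a + trunc m b) m.
Proof. by case: a => [a|]; case: b => [b|] /=; lia. Qed.

Lemma trunc_mul m a b : trunc m (cmul a b) = minn (trunc m a * trunc m b) m.
Proof. by case: a => [[|a]|]; case: b => [[|b]|] /=; nia. Qed.

Lemma trunc_succ m a : trunc m (omap succn a) = minn (trunc m a).+1 m.
Proof. by case: a => [a|] /=; lia. Qed.

Lemma trunc_leq m m' a b : m <= m' -> trunc m' a = trunc m' b -> trunc m a = trunc m b.
Proof. by case: a => [a|]; case: b => [b|] /=; lia. Qed.

Lemma trunc_sep a b : (forall m, trunc m a = trunc m b) -> a = b.
Proof.
case: a => [a|]; case: b => [b|] //= h.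
- by congr Some; have := h (maxn a b); lia.
- by have := h a.+1; lia.
- by have := h b.+1; lia.
Qed.

(** * Terms and formulas over the compactification *)

Fixpoint ceval (e : nat -> cnat) (t : term) : cnat :=
  match t with
  | Var x => e x
  | Zero => Some 0
  | Succ t => omap succn (ceval e t)
  | Add s t => cadd (ceval e s) (ceval e t)
  | Mul s t => cmul (ceval e s) (ceval e t)
  end.

Definition upd (T : Type) (e : nat -> T) (x : nat) (c : T) : nat -> T :=
  fun z => if z == x then c else e z.

Fixpoint csat (e : nat -> cnat) (A : form) : Prop :=
  match A with
  | Eq s t => ceval e s = ceval e t
  | Top => True
  | Bot => False
  | And A B => csat e A /\ csat e B
  | Or A B => csat e A \/ csat e B
  | Ex x A => exists c, csat (upd e x c) A
  | All _ _ _ => True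
  end.

Lemma ceval_ext e e' t : {in tvars t, e =1 e'} -> ceval e t = ceval e' t.
Proof.
elim: t => //= [x|t IH|s IHs t IHt|s IHs t IHt] h.
- by apply: h; rewrite inE.
- by rewrite IH.
- by rewrite IHs ?IHt // => z hz; apply: h; rewrite mem_cat hz ?orbT.
- by rewrite IHs ?IHt // => z hz; apply: h; rewrite mem_cat hz ?orbT.
Qed.

Lemma csat_ext_imp e e' A : {in fv A, e =1 e'} -> csat e A -> csat e' A.
Proof.
elim: A e e' => //= [s t|A IA B IB|A IA B IB|x A IA] e e' h.
- rewrite (@ceval_ext e e' s) ?(@ceval_ext e e' t) // => z hz; apply: h;
  by rewrite mem_cat hz ?orbT.
- move=> [a b]; split; [apply: IA a|apply: IB b] => z hz; apply: h;
  by rewrite mem_cat hz ?orbT.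
- move=> [a|b]; [left; apply: IA a|right; apply: IB b] => z hz; apply: h;
  by rewrite mem_cat hz ?orbT.
- move=> [c hc]; exists c; apply: IA hc => z hz; rewrite /upd.
  by case: eqP => // /eqP zx; apply: h; rewrite mem_filter zx.
Qed.

Lemma csat_ext e e' A : {in fv A, e =1 e'} -> csat e A <-> csat e' A.
Proof. by move=> h; split; apply: csat_ext_imp => z /h ->. Qed.

Lemma ceval_subst e s t : ceval e (tsubst s t) = ceval (ceval e \o s) t.
Proof. by elim: t => //= [t ->|t -> u ->|t -> u ->]. Qed.

Lemma csat_subst e s A :
  free_for s A -> csat e (subst s A) <-> csat (ceval e \o s) A.
Proof.
elim: A e s => //= [t u|A IA B IB|A IA B IB|x A IA] e s.
- by rewrite !ceval_subst.
- by case/andP=> fA fB; rewrite IA // IB.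
- by case/andP=> fA fB; rewrite IA // IB.
case/andP=> /allP fx fA.
have agree c : {in fv A, ceval (upd e x c) \o mask_sub [:: x] s
                         =1 upd (ceval e \o s) x c}.
  move=> z hz /=; rewrite mask_sub1E /upd.
  case: eqP => [-> /=|/eqP zx]; first by rewrite eqxx.
  apply: ceval_ext => w hw; case: eqP => // wx.
  by have := fx z; rewrite mem_filter zx hz -wx hw => /(_ isT).
by split=> -[c hc]; exists c; move: hc; rewrite (IA _ _ fA);
  apply: (csat_ext (agree c)).1 || apply: (csat_ext (agree c)).2.
Qed.

Lemma csat_sub1 e x t A : free_for (sub1 x t) A ->
  csat e (subst (sub1 x t) A) <-> csat (upd e x (ceval e t)) A.
Proof.
move=> fA; rewrite csat_subst //; apply: csat_ext => z _ /=.
by rewrite sub1E /upd; case: eqP.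
Qed.

Lemma trunc_ceval m e e' t : (forall z, trunc m (e z) = trunc m (e' z)) ->
  trunc m (ceval e t) = trunc m (ceval e' t).
Proof.
move=> h; elim: t => //= [t IH|s IHs t IHt|s IHs t IHt].
- by rewrite !trunc_succ IH.
- by rewrite !trunc_add IHs IHt.
- by rewrite !trunc_mul IHs IHt.
Qed.

(* The existential case is the compactness argument: if no finite witness works
   at arbitrarily fine scales, the witnesses tend to infinity. *)
Lemma csat_closed e A :
  (forall m, exists2 e', (forall z, trunc m (e' z) = trunc m (e z)) & csat e' A) ->
  csat e A.
Proof.
elim: A e => //= [s t||A IA B IB|A IA B IB|x A IA] e h.
- apply: trunc_sep => m; have [e' he' st] := h m.
  by rewrite -(trunc_ceval s he') -(trunc_ceval t he') st.
- by have [] := h 0.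
- split; [apply: IA|apply: IB] => m; have [e' he' [a b]] := h m;
  by exists e'.
- apply: contrapT => /not_orP[nA nB].
  (* If [A] is false at [e], it fails at every point within some scale [m]; approximations finer
     than [m] must then satisfy [B]. *)
  have [m hm] : exists m, forall e', (forall z, trunc m (e' z) = trunc m (e z)) -> ~ csat e' A.
    apply: contrapT => /forallNP k; apply: nA; apply: IA => m.
    by have /existsNP[e' /not_implyP[he' /contrapT a]] := k m; exists e'.
  apply: nB; apply: IB => m'; have [e' he' [a|b]] := h (maxn m m').
    case: (hm e' _ a) => z; apply: trunc_leq (he' z); exact: leq_maxl.
  exists e' => // z; apply: trunc_leq (he' z); exact: leq_maxr.
have [[n hn]|noP] := pselect (exists n, forall m, exists2 e',
    (forall z, trunc m (e' z) = trunc m (e z)) & csat (upd e' x (Some n)) A).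
  exists (Some n); apply: IA => m; have [e' he' a] := hn m.
  by exists (upd e' x (Some n)) => // z; rewrite /upd; case: eqP.
have bnd n : exists m, forall e', (forall z, trunc m (e' z) = trunc m (e z)) ->
    ~ csat (upd e' x (Some n)) A.
  apply: contrapT => /forallNP k; apply: noP; exists n => m.
  by have /existsNP[e' /not_implyP[he' /contrapT a]] := k m; exists e'.
have [g hg] := choice bnd.
exists None; apply: IA => m.
(* This scale is at least [m] and at least [g i] for all [i < m], so the witness [c] cannot be a
   number below [m]; hence [c] agrees with infinity at scale [m]. *)
have [e' he' [c hc]] := h (maxn m (\max_(i < m) g i)).
exists (upd e' x c) => // z; rewrite /upd.
case: eqP => // _; last by apply: trunc_leq (he' z); exact: leq_maxl.
case: c hc => [n|] //= hc; case: (ltnP n m) => [nm|]; last by lia.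
case: (hg n e' _ hc) => w; apply: trunc_leq (he' w).
by rewrite leq_max (leq_bigmax (Ordinal nm)) orbT.
Qed.

(** * Soundness of [BA] over the compactification *)

Lemma upd_id (T : Type) (e : nat -> T) x : upd e x (e x) = e.
Proof. by apply: funext => z; rewrite /upd; case: eqP => // ->. Qed.

Lemma upd_upd (T : Type) (e : nat -> T) x c d : upd (upd e x c) x d = upd e x d.
Proof. by apply: funext => z; rewrite /upd; case: eqP. Qed.

Lemma csat_upd e x c A : x \notin fv A -> csat (upd e x c) A <-> csat e A.
Proof.
move=> xA; apply: csat_ext => z zA; rewrite /upd; case: eqP => // zx.
by rewrite -zx zA in xA.
Qed.

(** Ordinary induction reaches the finite values of [x]; infinity is their limit, and truth is
    closed. *)
Lemma csat_induction x A :
  (forall e, csat e A -> csat (upd e x (omap succn (e x))) A) ->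
  forall e, csat (upd e x (Some 0)) A -> csat e A.
Proof.
move=> step e h0.
have hn n : csat (upd e x (Some n)) A.
  by elim: n => // n /step; rewrite upd_upd {2}/upd eqxx.
rewrite -(upd_id e x); case: (e x) => [n|] //.
(* At scale [m] the number [m] cannot be told from infinity. *)
apply: csat_closed => m; exists (upd e x (Some m)) => // z.
by rewrite /upd; case: eqP => //= _; rewrite minnn.
Qed.

(** Every axiom or rule specific to [All], the induction axiom included, concludes with an [All] and
    is sound at once: nothing detaches B from A and A -> B. The induction rule needs closedness,
    through [csat_induction]. *)
Lemma BA_csat A B : BA A B -> forall e, csat e A -> csat e B.
Proof.
have own_free x t C : {subset tvars t <= [:: x]} -> free_for (sub1 x t) C.
  move=> h; apply: free_for_own => z; rewrite sub1E; case: eqP => [->|_] //.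
elim=> {A B} //=.
- by move=> A B C e [a [b|c]]; [left|right].
- move=> x A B xA e [a [c b]]; exists c; split=> //.
  by rewrite csat_upd.
- move=> x y A atA e [xy a]; rewrite csat_sub1; last exact: free_for_atomic.
  by rewrite /= -xy upd_id.
- by move=> A B C _ h1 _ h2 e /h1/h2.
- by move=> A B C _ h1 _ h2 e a; split; [exact: h1|exact: h2].
- by move=> A B C _ h e /h[].
- by move=> A B C _ h e /h[].
- by move=> A B C _ h1 _ h2 e [/h1|/h2].
- by move=> A B C _ h e b; apply: h; left.
- by move=> A B C _ h e b; apply: h; right.
- by move=> x t A B fA fB _ h e; rewrite !csat_sub1 //; apply: h.
- by move=> x A B xA _ h e [c /h]; rewrite csat_upd.
- by move=> x A B xA _ h e b; apply: h; exists (e x); rewrite upd_id.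
- by move=> x e; case: (e x).
- by move=> x y e; case: (e x) => [m|]; case: (e y) => [n|] //= [->].
- by move=> x e; case: (e x) => [m|] //=; rewrite addn0.
- by move=> x y e; case: (e x) => [m|]; case: (e y) => [n|] //=; rewrite addnS.
- by move=> x e; case: (e x) => [[|m]|].
- move=> x y e; case: (e x) => [[|m]|]; case: (e y) => [[|n]|] //=.
    by move=> _; congr Some; lia.
  by move=> _; congr Some; lia.
- move=> x A _ step e; rewrite csat_sub1; last exact: own_free.
  apply: csat_induction => {}e /step.
  by rewrite csat_sub1 //; apply: own_free.
Qed.

(** * Standard truth and provably decidable sets *)

Lemma ceval_Some e t : ceval (Some \o e) t = Some (teval e t).
Proof.
elim: t => //= [t ->|s -> t ->|s -> t ->] //=.
by case: (teval e s) => [|m]; case: (teval e t) => [|n] //=; rewrite muln0.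
Qed.

(** The standard numbers form a substructure, [And], [Or] and [Ex] preserve truth along an
    embedding, and each [All] becomes true. Only this direction holds. *)
Lemma sat_csat e A : sat e A -> csat (Some \o e) A.
Proof.
elim: A e => //= [s t|A IA B IB|A IA B IB|x A IA] e.
- by rewrite !ceval_Some => ->.
- by move=> [/IA a /IB b].
- by move=> [/IA a|/IB b]; [left|right].
- move=> [e' [he' /IA a]]; exists (Some (e' x)).
  suff -> : upd (Some \o e) x (Some (e' x)) = Some \o e' by [].
  by apply: funext => z; rewrite /upd /=; case: eqP => [->|/eqP/he' ->].
Qed.

Lemma provably_decidable_fin_cofin X :
  provably_decidable X -> finite_set X \/ finite_set (~` X).
Proof.
move=> [A [xs [y [u [v [[_ uniq_xs fvA] [graph [_ [fu fv' func]]]]]]]]].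
case/tupleP: xs uniq_xs fvA graph => x xs; rewrite tuple0 /= => uniq_xs fvA graph.
pose e (a b : nat) : nat -> nat := upd (fun _ => a) y b.
move: uniq_xs; rewrite /= !inE !negb_or.
case/and4P => /and3P[yu yv yx] /andP[uv ux] vx _.
(* Graph points with value [b] and unbounded arguments converge to the point with infinite argument
   and value [b]. *)
have unbounded_csat (b : nat) : (forall m, exists2 n, m <= n & char_fun X n = b) ->
    csat (upd (fun=> None) y (Some b)) A.
  move=> h; apply: csat_closed => m; have [n mn Xn] := h m.
  exists (Some \o e n b).
    by move=> z; rewrite /e /upd /=; case: eqP => //= _; lia.
  by apply: sat_csat; apply/graph; rewrite /thead tnth_map tnth0 /e /upd /= eq_sym (negbTE yx) eqxx.
have not_both : ~ (csat (upd (fun=> None) y (Some 0)) A /\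
                   csat (upd (fun=> None) y (Some 1)) A).
  (* One assignment carries both values, 0 at [u] and 1 at [v], over an infinite [x]; soundness
     applied to [func] then yields [0 = 1]. *)
  move=> [h0 h1]; pose g := upd (upd (fun=> None : cnat) u (Some 0)) v (Some 1).
  have gu : g u = Some 0 by rewrite /g /upd (negbTE uv) eqxx.
  have gv : g v = Some 1 by rewrite /g /upd eqxx.
  have gx : g x = None by rewrite /g /upd eq_sym (negbTE vx) eq_sym (negbTE ux).
  have agree b : csat (upd (fun=> None) y b) A -> csat (upd g y b) A.
    apply: csat_ext_imp => z /fvA; rewrite !inE /upd.
    by case: eqP => //= _ /eqP ->; rewrite -/(upd _ _ _) gx.
  have : csat g (Eq (Var u) (Var v)).
    apply: (BA_csat func); split; rewrite csat_sub1 //= ?gu ?gv; exact: agree.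
  by rewrite /= gu gv.
have bounded_fin (Y : set nat) m : (forall n, m <= n -> ~ Y n) -> finite_set Y.
  move=> h; apply: sub_finite_set (finite_II m) => n Yn /=.
  by rewrite ltnNge; apply/negP => /h.
apply: contrapT => /not_orP[infX infC]; apply: not_both.
have unbounded (Y : set nat) : ~ finite_set Y -> forall m, exists2 n, m <= n & Y n.
  move=> infY m; apply: contrapT => noY; apply/infY/(bounded_fin _ m) => n mn Yn.
  by apply: noY; exists n.
split; apply: unbounded_csat => m.
- have [n mn Xn] := unbounded _ infC m; exists n => //.
  by rewrite /char_fun memNset.
- have [n mn Xn] := unbounded _ infX m; exists n => //.
  by rewrite /char_fun mem_set.
Qed.

(** * Tables of eventually constant functions *)

Lemma tsubst_fresh x t s : x \notin tvars s -> tsubst (sub1 x t) s = s.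
Proof.
elim: s => //= [z|s IH|s IHs s' IHs'|s IHs s' IHs'].
- by rewrite inE sub1E eq_sym => /negbTE ->.
- by move=> /IH ->.
- by rewrite mem_cat negb_or => /andP[/IHs -> /IHs' ->].
- by rewrite mem_cat negb_or => /andP[/IHs -> /IHs' ->].
Qed.

Lemma subst_id s A : (forall z, s z = Var z) -> subst s A = A.
Proof.
have mask_id xs s' : (forall z, s' z = Var z) -> forall z, mask_sub xs s' z = Var z.
  by move=> h z; rewrite /mask_sub h; case: ifP.
have tsubst_id t : forall s', (forall z, s' z = Var z) -> tsubst s' t = t.
  by move=> s' h; elim: t => //= [t ->|t -> u ->|t -> u ->].
elim: A s => //= [t u|A IA B IB|A IA B IB|x A IA|xs A IA B IB] s h.
- by rewrite !tsubst_id.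
- by rewrite IA ?IB.
- by rewrite IA ?IB.
- by rewrite IA //; apply: mask_id.
- by rewrite IA ?IB //; apply: mask_id.
Qed.

(** The rule [BA_exI] gives the case where [t] is [x] itself; substituting [t] for [x] leaves the
    right side unchanged, as [x] is bound there. *)
Lemma BA_ex_intro x t A : free_for (sub1 x t) A ->
  BA (subst (sub1 x t) A) (Ex x A).
Proof.
move=> fA.
have xA : x \notin fv (Ex x A) by rewrite /= mem_filter eqxx.
have -> : Ex x A = subst (sub1 x t) (Ex x A).
  rewrite /= subst_id // => z; rewrite mask_sub1E sub1E.
  by case: eqP.
apply: BA_subst => //; last exact: BA_exI xA (BA_id _).
have mid z : mask_sub [:: x] (sub1 x t) z = Var z.
  by rewrite mask_sub1E sub1E; case: eqP.
rewrite /= (@free_for_own (mask_sub _ _)) ?andbT; last first.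
  by move=> z; rewrite mid.
apply/allP => z; rewrite mem_filter => /andP[zx _].
by rewrite sub1E (negbTE zx) inE eq_sym.
Qed.

Lemma BA_fst A B : BA (And A B) A.
Proof. exact: BA_andEl (BA_id _). Qed.

Lemma BA_snd A B : BA (And A B) B.
Proof. exact: BA_andEr (BA_id _). Qed.

Lemma BA_andC A B : BA (And A B) (And B A).
Proof. exact: BA_andI (BA_snd _ _) (BA_fst _ _). Qed.

(** * Equality and numerals, for arbitrary terms *)

Definition tbound (t : term) : nat := \max_(i <- tvars t) i.

Lemma tbound_fresh t n : tbound t < n -> n \notin tvars t.
Proof.
by apply: contraTN => nt; rewrite -leqNgt; apply: (leq_bigmax_seq (P := xpredT)).
Qed.

Lemma BA_eq_refl_term t : BA Top (Eq t t).
Proof.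
have := @BA_subst 0 t Top (Eq (Var 0) (Var 0)) isT isT (BA_eq_refl 0).
by rewrite /= !sub1E.
Qed.

(* Substitution one variable at a time, through fresh variables. *)
Lemma BA_inst3 (A B : term -> term -> term -> form) s t r :
  (forall f a b c, free_for f (A a b c)) ->
  (forall f a b c, free_for f (B a b c)) ->
  (forall f a b c, subst f (A a b c) = A (tsubst f a) (tsubst f b) (tsubst f c)) ->
  (forall f a b c, subst f (B a b c) = B (tsubst f a) (tsubst f b) (tsubst f c)) ->
  (forall x y w, uniq [:: x; y; w] ->
     BA (A (Var x) (Var y) (Var w)) (B (Var x) (Var y) (Var w))) ->
  BA (A s t r) (B s t r).
Proof.
move=> fA fB sA sB h.
(* All three are fresh for [s] and [t], so a term already put in survives the later substitutions;
   [r] goes in last and may contain any variable. *)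
pose x := (tbound s + tbound t).+1; pose y := x.+1; pose w := y.+1.
have xy : (x == y) = false by apply/negbTE; rewrite /y; lia.
have xw : (x == w) = false by apply/negbTE; rewrite /w /y; lia.
have yw : (y == w) = false by apply/negbTE; rewrite /w; lia.
have {}h : BA (A (Var x) (Var y) (Var w)) (B (Var x) (Var y) (Var w)).
  by apply: h; rewrite /= !inE xy xw yw.
have := @BA_subst x s _ _ (fA _ _ _ _) (fB _ _ _ _) h.
rewrite sA sB /= !sub1E eqxx ![_ == x]eq_sym xy xw => {}h.
have := @BA_subst y t _ _ (fA _ _ _ _) (fB _ _ _ _) h.
rewrite sA sB /= !sub1E eqxx [w == y]eq_sym yw tsubst_fresh; last first.
  by apply: tbound_fresh; rewrite /y /x; lia.
move=> {}h; have := @BA_subst w r _ _ (fA _ _ _ _) (fB _ _ _ _) h.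
by rewrite sA sB /= !sub1E eqxx !tsubst_fresh //;
  apply: tbound_fresh; rewrite /w /y /x; lia.
Qed.

(** This is [BA_eq_subst] for the atom [x = w]; with reflexivity it yields symmetry and
    transitivity. *)
Lemma BA_eq_euclid s t r : BA (And (Eq s t) (Eq s r)) (Eq t r).
Proof.
apply: (BA_inst3 (A := fun s t r => And (Eq s t) (Eq s r))
                 (B := fun s t r => Eq t r)) => // x y w.
rewrite /= !inE negb_or => /andP[/andP[xy xw] _].
have := @BA_eq_subst x y (Eq (Var x) (Var w)) isT.
by rewrite /= !sub1E eqxx eq_sym (negbTE xw).
Qed.

Lemma BA_from_top A B : BA Top B -> BA A B.
Proof. exact: BA_trans (BA_top A). Qed.

Lemma BA_eq_sym s t : BA (Eq s t) (Eq t s).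
Proof.
apply: BA_trans (BA_eq_euclid s t s).
by apply: BA_andI (BA_id _) _; apply/BA_from_top/BA_eq_refl_term.
Qed.

Lemma BA_eq_trans A s t r : BA A (Eq s t) -> BA A (Eq t r) -> BA A (Eq s r).
Proof.
move=> h1 h2; apply: BA_trans (BA_eq_euclid t s r).
by apply: BA_andI h2; apply: BA_trans h1 (BA_eq_sym _ _).
Qed.

Lemma BA_succ_congr s t : BA (Eq s t) (Eq (Succ s) (Succ t)).
Proof.
(* The right side gets a variable of its own, instantiated by [s] afterwards, so that the
   replacement acts on the left side only. *)
have h : BA (And (Eq s t) (Eq (Succ s) (Succ s))) (Eq (Succ t) (Succ s)).
  apply: (BA_inst3 (A := fun s t r => And (Eq s t) (Eq (Succ s) (Succ r)))
                   (B := fun s t r => Eq (Succ t) (Succ r))) => // x y w.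
  rewrite /= !inE negb_or => /andP[/andP[xy xw] _].
  have := @BA_eq_subst x y (Eq (Succ (Var x)) (Succ (Var w))) isT.
  by rewrite /= !sub1E eqxx eq_sym (negbTE xw).
apply: BA_trans (BA_eq_sym _ _); apply: BA_trans h.
by apply: BA_andI (BA_id _) _; apply/BA_from_top/BA_eq_refl_term.
Qed.

Lemma BA_succ_inj_term s t : BA (Eq (Succ s) (Succ t)) (Eq s t).
Proof.
apply: (BA_inst3 (A := fun s t _ => Eq (Succ s) (Succ t))
                 (B := fun s t _ => Eq s t) s t Zero) => // x y _ _.
exact: BA_succ_inj.
Qed.

Lemma BA_succ_neq0_term t : BA (Eq (Succ t) Zero) Bot.
Proof.
have := @BA_subst 0 t (Eq (Succ (Var 0)) Zero) Bot isT isT (BA_succ_neq0 0).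
by rewrite /= sub1E.
Qed.

Definition num n := iter n Succ Zero.

(** Cancelling the [n] common successors leaves a successor equal to zero. As [t] is arbitrary, this
    separates two numerals and also a numeral from the unbounded row of a table. *)
Lemma BA_iter_succ_neq t m n : n < m -> BA (Eq (iter m Succ t) (num n)) Bot.
Proof.
elim: m n => // m IH [|n] nm; first exact: BA_succ_neq0_term.
exact: BA_trans (BA_succ_inj_term _ _) (IH n nm).
Qed.

(** * Finite disjunctions and tables *)

Definition disj (As : seq form) : form := foldr Or Bot As.

Lemma BA_disjI (I : eqType) (F : I -> form) (r : seq I) i :
  i \in r -> BA (F i) (disj (map F r)).
Proof.
elim: r => // j r IH; rewrite inE => /predU1P[<-|/IH h].
  exact: BA_orIl (BA_id _).
exact: BA_trans h (BA_orIr (BA_id _)).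
Qed.

(** The side formula [A] is carried along by distributivity: without modus ponens it cannot be moved
    into an implication and recovered. *)
Lemma BA_disjE (I : eqType) (F : I -> form) (r : seq I) A C :
  {in r, forall i, BA (And A (F i)) C} -> BA (And A (disj (map F r))) C.
Proof.
elim: r => [_|i r IH h]; first exact: BA_trans (BA_snd _ _) (BA_bot _).
apply: BA_trans (BA_distr _ _ _) _; apply: BA_orE.
  by apply: h; rewrite inE eqxx.
by apply: IH => j jr; apply: h; rewrite inE jr orbT.
Qed.

(* The row [Some j], with [j < N], is the point (j, f j) of the graph;
   the row [None] is the constant part of [f] beyond [N], [z] being the excess
   of the argument over [N]. *)
Definition rows N : seq (option nat) := None :: map Some (iota 0 N).

Definition row_arg N z (i : option nat) : term :=
  if i is Some j then num j else iter N Succ z.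

Definition row_val N (f : nat -> nat) (i : option nat) : nat :=
  f (if i is Some j then j else N).

Definition row N f x y z i : form :=
  And (Eq x (row_arg N z i)) (Eq y (num (row_val N f i))).

Definition table N f x y z : form := disj (map (row N f x y z) (rows N)).

Lemma mem_rows N i : (i \in rows N) = if i is Some j then j < N else true.
Proof.
rewrite inE; case: i => [j|] //=.
by rewrite mem_map ?mem_iota //; move=> ? ? [].
Qed.

Lemma free_for_table s N f x y z : free_for s (table N f x y z).
Proof. by rewrite /table; elim: (rows N). Qed.

Lemma tsubst_iter s n t : tsubst s (iter n Succ t) = iter n Succ (tsubst s t).
Proof. by elim: n => //= n ->. Qed.

Lemma subst_table s N f x y z :
  subst s (table N f x y z) = table N f (tsubst s x) (tsubst s y) (tsubst s z).
Proof.
rewrite /table; elim: (rows N) => //= i r ->; rewrite /row; congr (Or (And (Eq _ _) (Eq _ _)) _).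
  by case: i => [j|] /=; rewrite tsubst_iter.
by rewrite tsubst_iter.
Qed.

Lemma tvars_iter n t : tvars (iter n Succ t) = tvars t.
Proof. by elim: n. Qed.

Lemma fv_table N f x y z :
  {subset fv (table N f x y z) <= tvars x ++ tvars y ++ tvars z}.
Proof.
move=> w; rewrite /table; elim: (rows N) => //= i r IH.
rewrite mem_cat => /orP[|//]; rewrite !mem_cat tvars_iter /=.
by case: i => [j|] /=; rewrite tvars_iter /=; do ?[case/orP]; move=> // ->; rewrite ?orbT.
Qed.

Lemma Delta0_table N f x y z : Delta0 (table N f x y z).
Proof.
rewrite /table; elim: (rows N) => [|i r IH] /=; first exact: Delta0_atomic.
by apply: Delta0_or IH; apply: Delta0_and; apply: Delta0_atomic.
Qed.

Lemma teval_iter e n t : teval e (iter n Succ t) = n + teval e t.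
Proof. by elim: n => //= n ->. Qed.

Lemma sat_table e N f x y z :
  sat e (table N f x y z) <->
  exists2 i, i \in rows N & teval e x = teval e (row_arg N z i) /\
                            teval e y = row_val N f i.
Proof.
rewrite /table; elim: (rows N) => [|i r IH] /=; first by split=> // -[].
rewrite IH teval_iter addn0; split.
  by move=> [h|[j jr h]]; [exists i|exists j] => //; rewrite inE ?eqxx ?jr ?orbT.
move=> [j]; rewrite inE => /predU1P[->|jr] h; [by left|right].
by exists j.
Qed.

(** Equal rows carry the same numeral; distinct rows have provably different arguments, whatever the
    excesses [z] and [z']. *)
Lemma BA_row_functional N f x u v z z' i j :
  i \in rows N -> j \in rows N ->
  BA (And (row N f x u z i) (row N f x v z' j)) (Eq u v).
Proof.
move=> iN jN.
set D := And _ _.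
have Dl : BA D (row N f x u z i) by exact: BA_fst.
have Dr : BA D (row N f x v z' j) by exact: BA_snd.
have hu := BA_andEr Dl; have hv := BA_andEr Dr.
have args : BA D (Eq (row_arg N z i) (row_arg N z' j)).
  by apply: BA_eq_trans (BA_trans (BA_andEl Dl) (BA_eq_sym _ _)) (BA_andEl Dr).
have [eq_ij|ne_ij] := eqVneq i j.
  rewrite -eq_ij in hv.
  exact: BA_eq_trans hu (BA_trans hv (BA_eq_sym _ _)).
suff : BA D Bot by move/BA_trans; apply; apply: BA_bot.
apply: BA_trans args _.
move: iN jN ne_ij; rewrite !mem_rows; case: i {D Dl Dr hu hv} => [i|]; case: j => [j|] //= iN jN ne_ij.
- have [ij|ji|e] := ltngtP i j.
  + by apply: BA_trans (BA_eq_sym _ _) _; apply: BA_iter_succ_neq.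
  + exact: BA_iter_succ_neq.
  + by rewrite e eqxx in ne_ij.
- by apply: BA_trans (BA_eq_sym _ _) _; apply: BA_iter_succ_neq.
- exact: BA_iter_succ_neq.
Qed.

Lemma BA_table_functional N f x u v z z' :
  BA (And (table N f x u z) (table N f x v z')) (Eq u v).
Proof.
apply: BA_disjE => j jN; apply: BA_trans (BA_andC _ _) _.
apply: BA_disjE => i iN; apply: BA_trans (BA_andC _ _) _.
exact: BA_row_functional.
Qed.

(** The witness [t] may contain [z] itself, as when the excess passes from [z] to [Succ z] in the
    proof of totality. *)
Lemma BA_ex_table_intro N f x t y z : z \notin tvars x -> z \notin tvars y ->
  BA (table N f x y t) (Ex z (table N f x y (Var z))).
Proof.
move=> zx zy.
have := @BA_ex_intro z t (table N f x y (Var z)) (free_for_table _ _ _ _ _ _).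
by rewrite subst_table (tsubst_fresh _ zx) (tsubst_fresh _ zy) /= sub1E eqxx.
Qed.

Lemma BA_ex2_table_intro N f x t y z s : y != z ->
  y \notin tvars x -> z \notin tvars x -> z \notin tvars s ->
  BA (table N f x s t) (Ex y (Ex z (table N f x (Var y) (Var z)))).
Proof.
move=> yz yx zx zs; apply: BA_trans (BA_ex_table_intro N f t zx zs) _.
have E : subst (sub1 y s) (Ex z (table N f x (Var y) (Var z))) =
         Ex z (table N f x s (Var z)).
  rewrite subst_ex subst_table /=; congr (Ex z (table N f _ _ _)).
  + rewrite -[RHS](tsubst_fresh s yx).
    elim: (x) zx => //= [w|w IH|a IHa b IHb|a IHa b IHb].
    * by rewrite inE mask_sub1E eq_sym => /negbTE ->.
    * by move=> /IH ->.
    * by rewrite mem_cat negb_or => /andP[/IHa -> /IHb ->].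
    * by rewrite mem_cat negb_or => /andP[/IHa -> /IHb ->].
  + by rewrite mask_sub1E (negbTE yz) sub1E eqxx.
  + by rewrite mask_sub1E eqxx.
rewrite -E; apply: BA_ex_intro.
rewrite free_for_ex free_for_table andbT; apply/allP => w.
rewrite fv_ex mem_filter => /andP[wz _]; rewrite sub1E; case: eqP => //= _.
by rewrite inE eq_sym.
Qed.

(** * Totality, then functionality, of the quantified table *)

Lemma tvars_num n : tvars (num n) = [::].
Proof. exact: tvars_iter. Qed.

Lemma BA_row_table N f x z i :
  i \in rows N -> BA (Eq x (row_arg N z i)) (table N f x (num (row_val N f i)) z).
Proof.
move=> iN.
apply: BA_trans (BA_disjI (row N f x (num (row_val N f i)) z) iN).
by apply: BA_andI (BA_id _) _; apply/BA_from_top/BA_eq_refl_term.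
Qed.

Lemma row_arg_zero N : exists i t, i \in rows N /\ Zero = row_arg N t i.
Proof.
by case: N => [|N]; [exists None, Zero|exists (Some 0), Zero]; rewrite mem_rows.
Qed.

(** The successor leads to the next row, from [N - 1] to the row [None] with excess zero, and inside
    [None] to a larger excess. The equality is syntactic. *)
Lemma row_arg_succ N z i : i \in rows N ->
  exists i' t, i' \in rows N /\ Succ (row_arg N z i) = row_arg N t i'.
Proof.
rewrite mem_rows; case: i => [j|_] /=; last first.
  by exists None, (Succ z); rewrite mem_rows /= -iterSr.
rewrite leq_eqVlt => /predU1P[<-|jN]; first by exists None, Zero; rewrite mem_rows.
by exists (Some j.+1), Zero; rewrite mem_rows.
Qed.

(** Induction rule on [x] for the existential formula [C]: zero lies in some row, and successors
    lead from row to row. *)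
Lemma BA_table_total N f x y z : uniq [:: x; y; z] ->
  BA Top (Ex y (Ex z (table N f (Var x) (Var y) (Var z)))).
Proof.
rewrite /= !inE negb_or => /andP[/andP[xy xz] /andP[yz _]].
pose C t := Ex y (Ex z (table N f t (Var y) (Var z))).
have subC t : subst (sub1 x t) (C (Var x)) = C t.
  rewrite !subst_ex subst_table /= !mask_sub1E !sub1E !eqxx.
  by rewrite (negbTE xy) (negbTE xz) (negbTE yz).
have introC A t i r : y \notin tvars t -> z \notin tvars t -> i \in rows N ->
    BA A (Eq t (row_arg N r i)) -> BA A (C t).
  move=> yt zt iN h; apply: BA_trans h _; apply: BA_trans (BA_row_table f t r iN) _.
  by apply: BA_ex2_table_intro => //; rewrite tvars_num.
have yx : y \notin [:: x] by rewrite inE eq_sym.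
have zx : z \notin [:: x] by rewrite inE eq_sym.
apply: (BA_trans (B := C Zero)).
  have [i [t [iN E]]] := row_arg_zero N.
  by apply: (introC _ _ i t) => //; rewrite -E; apply: BA_eq_refl_term.
rewrite -subC; apply: BA_induction_rule; rewrite subC.
apply: BA_exE; first by rewrite fv_ex mem_filter eqxx.
apply: BA_exE; first by rewrite !fv_ex !mem_filter eqxx andbF.
(* [Top] serves as the side formula that [BA_disjE] expects. *)
apply: (BA_trans (BA_andI (BA_top _) (BA_id _))).
apply: BA_disjE => i iN; apply: BA_trans (BA_snd _ _) _.
apply: BA_trans (BA_fst _ _) _.
have [i' [t [iN' E]]] := row_arg_succ (Var z) iN.
by apply: (introC _ _ i' t) => //; rewrite -E; apply: BA_succ_congr.
Qed.

(** Both instances bind the same [z]; one is renamed to [w], so that [BA_distr_ex] can pull out the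
    two quantifiers in turn. *)
Lemma BA_ex_table_functional N f x u v z w :
  z \notin [:: x; u; v] -> w \notin [:: z; x; u; v] ->
  BA (And (Ex z (table N f (Var x) (Var u) (Var z)))
          (Ex z (table N f (Var x) (Var v) (Var z))))
     (Eq (Var u) (Var v)).
Proof.
rewrite !inE !negb_or => /and3P[zx zu zv] /and4P[wz wx wu wv].
have rename : BA (Ex z (table N f (Var x) (Var u) (Var z)))
                 (Ex w (table N f (Var x) (Var u) (Var w))).
  apply: BA_exE; last by apply: BA_ex_table_intro; rewrite inE.
  rewrite fv_ex mem_filter; apply/nandP; right; apply/negP => /fv_table.
  by rewrite !inE (negbTE zx) (negbTE zu) eq_sym (negbTE wz).
apply: BA_trans (BA_andI (BA_trans (BA_fst _ _) rename) (BA_snd _ _)) _.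
apply: BA_trans (BA_distr_ex _ _) _.
  rewrite fv_ex mem_filter; apply/nandP; right; apply/negP => /fv_table.
  by rewrite !inE (negbTE zx) (negbTE zu) eq_sym (negbTE wz).
apply: BA_exE; first by rewrite !inE negb_or zu.
apply: BA_trans (BA_andC _ _) _.
apply: BA_trans (BA_distr_ex _ _) _.
  by apply/negP => /fv_table; rewrite !inE (negbTE wx) (negbTE wv) (negbTE wz).
apply: BA_exE; first by rewrite !inE negb_or wu.
exact: BA_trans (BA_andC _ _) (BA_table_functional _ _ _ _ _ _ _).
Qed.

(** * The graph of an eventually constant function *)

Lemma sat_ex_table e N f x y z : z \notin [:: x; y] ->
  (forall n, N <= n -> f n = f N) ->
  sat e (Ex z (table N f (Var x) (Var y) (Var z))) <-> f (e x) = e y.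
Proof.
rewrite !inE negb_or ![z == _]eq_sym => /andP[xz yz] fN; split.
  case=> e' [he' /sat_table[i]]; rewrite mem_rows /= !he' //.
  case: i => [j|] iN /= [-> ->]; rewrite teval_iter ?addn0 //.
  by rewrite fN // leq_addr.
(* The witness is the excess over [N]; below [N] it is 0, and the row of [e x] ignores it. *)
move=> fe; exists (upd e z (e x - N)); split=> [w|].
  by rewrite /upd => /negbTE ->.
apply/sat_table => /=; rewrite /upd (negbTE xz) (negbTE yz).
have [xN|Nx] := ltnP (e x) N.
  exists (Some (e x)); first by rewrite mem_rows.
  by rewrite /= teval_iter addn0.
exists None; first by rewrite mem_rows.
by rewrite /= teval_iter /= eqxx subnKC // /row_val -fe fN.
Qed.

Lemma provably_recursive_eventually_const (f : nat -> nat) N :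
  (forall n, N <= n -> f n = f N) ->
  provably_recursive (fun a : 1.-tuple nat => f (thead a)).
Proof.
(* Variable 0 is the argument, 1 the value, 2 and 3 its two copies, 4 the excess. *)
move=> fN; exists (Ex 4 (table N f (Var 0) (Var 1) (Var 4))), [tuple 0], 1, 2, 3.
have freeT t : 4 \notin tvars t ->
    free_for (sub1 1 t) (Ex 4 (table N f (Var 0) (Var 1) (Var 4))).
  move=> t4; rewrite free_for_ex free_for_table andbT; apply/allP => w.
  rewrite fv_ex mem_filter => /andP[w4 _]; rewrite sub1E; case: eqP => //= _.
  by rewrite inE eq_sym.
split; [split=> //|split; [|split; [|split]]].
- by exists [:: 4], (table N f (Var 0) (Var 1) (Var 4)); split=> //; apply: Delta0_table.
- move=> w; rewrite fv_ex mem_filter => /andP[w4 /fv_table]; rewrite !inE (negbTE w4) orbF.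
  by rewrite orbC.
- by move=> e; rewrite sat_ex_table // /thead tnth_map tnth0.
- exact: BA_table_total.
- exact: freeT.
- exact: freeT.
(* Variable 5 is fresh and renames the excess of one copy. *)
- by rewrite !subst_ex !subst_table; apply: (@BA_ex_table_functional _ _ _ _ _ _ 5).
Qed.

Lemma fin_cofin_eventually_const X : finite_set X \/ finite_set (~` X) ->
  exists N, forall n, N <= n -> char_fun X n = char_fun X N.
Proof.
have bound (Y : set nat) : finite_set Y -> exists N, forall n, N <= n -> ~ Y n.
  move=> /finite_seqP[s ->]; exists (\max_(i <- s) i).+1 => n lt_n /= ns.
  by move: lt_n; rewrite ltnNge (leq_bigmax_seq (P := xpredT)).
case=> /bound[N hN]; exists N => n Nn; rewrite /char_fun.
  by rewrite !memNset //; apply: hN.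
by rewrite !mem_set //; apply: contrapT; apply: hN.
Qed.

Theorem theorem3p17 (X : set nat) :
  provably_decidable X <-> (finite_set X \/ finite_set (~` X)).
Proof.
split; first exact: provably_decidable_fin_cofin.
by move=> /fin_cofin_eventually_const[N /provably_recursive_eventually_const].
Qed.
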